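(* Let $\mathbf{M}=(c_{i,j})_{i,j=0}^{\infty}$ be an HPD matrix and let $\mathcal{D}:\mathbb{P}[z]\to\mathbb{P}[z]$, $\mathcal{D}(p)(z)=zp(z)$, be the multiplication operator. Assume that $\mathcal{D}$ is bounded on $\mathbb{P}[z]$ with respect to $\langle\cdot,\cdot\rangle_{\mathbf{M}}$. Then $$\limsup_{n\to\infty}\frac{c_{n+1,n+1}}{c_{n,n}}\le\|\mathcal{D}\|^2.$$
   Context: $\mathbb{P}[z]$ is the space of polynomials in $z$ with complex coefficients. An infinite Hermitian matrix $\mathbf{M}=(c_{i,j})_{i,j=0}^{\infty}$ is HPD (Hermitian positive definite) if all its finite truncated sections are positive definite. It defines an inner product on $\mathbb{P}[z]$ by $\langle p,q\rangle_{\mathbf{M}}=v\mathbf{M}w^*$ where $p(z)=\sum_n v_nz^n$, $q(z)=\sum_n w_nz^n$ (coefficient row vectors with finitely many nonzero entries), with norm $\|p\|_{\mathbf{M}}^2=\langle p,p\rangle_{\mathbf{M}}$. $\mathcal{D}$ is bounded if $\|\mathcal{D}\|=\sup\{\|zp(z)\|_{\mathbf{M}}: p\in\mathbb{P}[z],\ \|p\|_{\mathbf{M}}=1\}<\infty$. *)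

(* Defs.v *)
From HB Require Import structures.
From mathcomp Require Import all_boot all_order all_algebra.
From mathcomp Require Import all_classical all_reals all_analysis.
From mathcomp Require Import complex.

Set Implicit Arguments.
Unset Strict Implicit.
Unset Printing Implicit Defensive.

Import Order.TTheory GRing.Theory Num.Theory.

Local Open Scope classical_set_scope.
Local Open Scope ring_scope.
Local Open Scope complex_scope.

Definition infmx (R : realType) := nat -> nat -> R[i].

Definition mxsection (R : realType) (M : infmx R) (n : nat) : 'M[R[i]]_n :=
  \matrix_(i < n, j < n) M i j.

(* [0 < z] in [R[i]] says that [z] is real and positive. *)
Definition posdefmx (R : realType) (n : nat) (A : 'M[R[i]]_n) : Prop :=
  forall v : 'rV[R[i]]_n, v != 0 -> 0 < form Num.conj A v v.

Definition HPD (R : realType) (M : infmx R) : Prop :=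
  (forall i j, M i j = Num.conj (M j i)) /\
  (forall n, posdefmx (mxsection M n)).

(* [v M w^*] for the coefficient rows [v], [w] of [p], [q], which vanish from
   [size p], [size q] on. *)
Definition mxdot (R : realType) (M : infmx R) (p q : {poly R[i]}) : R[i] :=
  \sum_(i < size p) \sum_(j < size q) p`_i * M i j * Num.conj q`_j.

(* For HPD [M], [mxdot M p p] is a nonnegative real; [Re] only casts it to [R]. *)
Definition mxnorm (R : realType) (M : infmx R) (p : {poly R[i]}) : R :=
  Num.sqrt (complex.Re (mxdot M p p)).

Definition mulz (R : realType) (p : {poly R[i]}) : {poly R[i]} := 'X * p.

Definition opnorm (R : realType) (M : infmx R)
    (T : {poly R[i]} -> {poly R[i]}) : \bar R :=
  ereal_sup [set (mxnorm M (T p))%:E | p in [set p | mxnorm M p = 1]].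

Definition bounded_op (R : realType) (M : infmx R)
    (T : {poly R[i]} -> {poly R[i]}) : Prop :=
  (opnorm M T < +oo)%E.

(* For HPD [M] the diagonal entries are positive reals, and so is the ratio;
   [Re] only casts it to [R]. *)
Definition diag_ratio (R : realType) (M : infmx R) (n : nat) : R :=
  complex.Re (M n.+1 n.+1 / M n n).

(* Main.v *)
(** The normalized monomial [z^n / sqrt c_(n,n)] has norm [1] and is sent by
    multiplication by [z] to a polynomial of norm [sqrt (c_(n+1,n+1) / c_(n,n))];
    hence every single ratio, not only the limit superior, is at most the
    squared operator norm. *)

Require Import Defs.
From HB Require Import structures.
From mathcomp Require Import all_boot all_order all_algebra.
From mathcomp Require Import all_classical all_reals all_analysis.
From mathcomp Require Import complex.

Set Implicit Arguments.
Unset Strict Implicit.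
Unset Printing Implicit Defensive.

Import Order.TTheory GRing.Theory Num.Theory.

Local Open Scope classical_set_scope.
Local Open Scope ring_scope.
Local Open Scope complex_scope.

(** The section of size [n.+1] is the smallest one containing [M n n]; its form at the last basis
    vector is that entry. *)
Lemma HPD_diag_gt0 (R : realType) (M : infmx R) (n : nat) :
  HPD M -> 0 < M n n.
Proof.
move=> [_ /(_ n.+1 (delta_mx 0 ord_max))].
rewrite formee mxE /=; apply; apply/eqP => /rowP/(_ ord_max).
by rewrite !mxE !eqxx => /eqP; rewrite oner_eq0.
Qed.

Lemma mxdot_monomial (R : realType) (M : infmx R) (a b : R[i]) (m n : nat) :
  mxdot M (a *: 'X^m) (b *: 'X^n) = a * M m n * Num.conj b.
Proof.
(* A zero coefficient is treated apart, since the polynomial then has size 0 and its sum is empty.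
   Otherwise the sizes are [m.+1] and [n.+1], and only the top index of each sum contributes. *)
rewrite /mxdot; have [->|a0] := eqVneq a 0.
  by rewrite scale0r size_poly0 big_ord0 !mul0r.
have [->|b0] := eqVneq b 0.
  rewrite scale0r size_poly0 rmorph0 mulr0 big1// => i _.
  by rewrite big_ord0.
rewrite !size_scale// !size_polyXn big_ord_recr/= big1 ?add0r => [|i _]; last first.
  by rewrite big1// => j _; rewrite coefZ coefXn ltn_eqF// mulr0 !mul0r.
rewrite big_ord_recr/= big1 ?add0r => [|j _]; last first.
  by rewrite [X in Num.conj X]coefZ coefXn ltn_eqF// mulr0 rmorph0 mulr0.
by rewrite !coefZ !coefXn !eqxx !mulr1.
Qed.

Lemma mxnorm_monomial (R : realType) (M : infmx R) (a : R) (n : nat) :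
  mxnorm M (a%:C *: 'X^n) = Num.sqrt (a ^+ 2 * complex.Re (M n n)).
Proof.
rewrite /mxnorm mxdot_monomial; case: (M n n) => x y /=.
by congr Num.sqrt; rewrite /= !(mul0r, mulr0, subr0, addr0, oppr0) expr2 mulrAC.
Qed.

Lemma diag_ratioE (R : realType) (M : infmx R) (n : nat) : HPD M ->
  diag_ratio M n = complex.Re (M n.+1 n.+1) / complex.Re (M n n).
Proof.
move=> hM; rewrite /diag_ratio.
have := HPD_diag_gt0 n hM; case: (M n n) => x y.
(* Positivity in [R[i]] forces the imaginary part of the denominator to vanish, so its inverse is
   [x / x ^+ 2] and the real part passes through the quotient. *)
rewrite ltcE /= => /andP[/eqP-> x0].
case: (M n.+1 n.+1) => u v /=.
by rewrite expr0n /= addr0 mul0r oppr0 mulr0 subr0 expr2 invfM mulVKf ?gt_eqF.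
Qed.

Lemma limn_esup_le (R : realType) (u : (\bar R)^nat) (l : \bar R) :
  (forall n, (u n <= l)%E) -> (limn_esup u <= l)%E.
Proof.
move=> ul; apply: (@le_trans _ _ (ereal_sup (range u))).
  (* The limit superior is an infimum of suprema over the sets of the filter at infinity, and the
     whole of [nat] is one of them. *)
  by apply: ereal_inf_lbound; exists setT => //; exact: filterT.
by apply: ge_ereal_sup => _ [n _ <-].
Qed.

Theorem proposition2 (R : realType) (M : infmx R) (hM : HPD M)
    (hD : bounded_op M (@mulz R)) :
  (limn_esup (fun n : nat => (diag_ratio M n)%:E)
     <= opnorm M (@mulz R) ^+ 2)%E.
Proof.
apply: limn_esup_le => n.
have Re_gt0 k : 0 < complex.Re (M k k).
  by have := HPD_diag_gt0 k hM; rewrite ltcE => /andP[].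
pose a : R := (Num.sqrt (complex.Re (M n n)))^-1.
have a2 : a ^+ 2 = (complex.Re (M n n))^-1 by rewrite exprVn sqr_sqrtr// ltW.
pose p : {poly R[i]} := a%:C *: 'X^n.
have zp : mulz p = a%:C *: 'X^(n.+1).
  by rewrite /mulz /p -scalerAr -exprS.
have ratioE : diag_ratio M n = mxnorm M (mulz p) ^+ 2.
  rewrite zp mxnorm_monomial a2 sqr_sqrtr ?diag_ratioE// 1?mulrC//.
  by rewrite mulr_ge0 ?invr_ge0// ltW.
have le_norm : ((mxnorm M (mulz p))%:E <= opnorm M (@mulz R))%E.
  apply: ereal_sup_ubound; exists p => //=.
  by rewrite /p mxnorm_monomial a2 mulVf ?sqrtr1// gt_eqF.
have norm_ge0 : (0 <= (mxnorm M (mulz p))%:E)%E.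
  by rewrite lee_fin sqrtr_ge0.
(* Squaring preserves the order only between nonnegative terms; [opnorm] is nonnegative because it
   dominates the norm of [mulz p]. *)
by rewrite ratioE EFin_expe lee_sqr// (le_trans norm_ge0).
Qed.
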